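(* Let $A$ and $B$ be the generators of a free group on two generators, and let $C=ABA^{-1}$ and $D=B$. Let $W_F$ be the algorithm/Farey word in $C$ and $D$ with primitive exponents $(v_1,\dots,v_t)$, so that $$W_F(C,D)=C^{-1}D^{v_1}\cdots C^{-1}D^{v_t}=AB^{-1}A^{-1}\cdot B^{v_1}\cdots AB^{-1}A^{-1}\cdot B^{v_t}.$$ Then $W_F\cdot A$ is a good word in $A$ and $B$.
   Context: Good words. Let $G=\langle A,B\rangle$ be the free group on $A$ and $B$. A good word in $A$ and $B$ is a word that starts and ends with $A$ or its inverse and in which the exponents of $A$ are $\pm1$ and alternate in sign, i.e. a word of the form $A^{u_1}B^{g_1}A^{u_2}B^{g_2}\cdots B^{g_{s-1}}A^{u_s}$ with $u_1=\pm1$, $u_{l+1}=-u_l$ for all $l$, and each $g_l$ a nonzero integer. Primitive words and primitive exponents. A primitive word in two free generators $X,Y$ is a word that can be extended to a minimal set of generators of the group. Up to cyclic permutation and interchanging the generators, a primitive word can be written in a canonical form in which all exponents of one generator are equal to each other and are $\pm1$, e.g. $X^{-1}Y^{v_1}X^{-1}Y^{v_2}\cdots X^{-1}Y^{v_t}$; the integers $v_1,\dots,v_t$ are called its primitive exponents. Farey (algorithm) words. For a rational number $p/q$ between $0$ and $1$ (in lowest terms), the Farey word $W_{p/q}(X,Y)$ is the primitive word in $X,Y$ written as $X^{-1}Y^{v_1}\cdots X^{-1}Y^{v_t}$ with $t=p$ and $\sum_{l=1}^t v_l=q$. It is the word arising from the continued fraction expansion $\frac pq=[a_0,\dots,a_k]=\cfrac{1}{a_0+\cfrac{1}{a_1+\cdots}}$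 (with positive integers $a_l$) as follows: put $(X_0,Y_0)=(X,Y)$ and $(X_{l+1},Y_{l+1})=(Y_l^{-1},X_l^{-1}Y_l^{a_l})$ for $l=0,\dots,k$; the word is $Y_{k+1}$, written (up to cyclic permutation) in the canonical form above. These are the words produced by the discreteness algorithm, and are also called algorithm words. *)

(* Defs.v *)
From mathcomp Require Import all_boot all_order all_algebra.
From mathcomp Require Import zify.

Set Implicit Arguments.
Unset Strict Implicit.
Unset Printing Implicit Defensive.

Import Order.TTheory GRing.Theory Num.Theory.
Local Open Scope ring_scope.

(* The letter (i, s) stands for the generator number i (false: the first one,
   true: the second one), inverted when s = true. Words are plain strings of
   letters, not taken up to free reduction. *)
Definition letter : Type := (bool * bool)%type.
Definition word : Type := seq letter.

Definition linv (l : letter) : letter := (l.1, ~~ l.2).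
Definition winv (w : word) : word := rev (map linv w).
Definition wexp (w : word) (n : nat) : word := flatten (nseq n w).

(* The power n of the generator number i; the empty word when n = 0. *)
Definition gpow (i : bool) (n : int) : word := nseq `|n|%N (i, n < 0).

Definition reduced (w : word) : bool := sorted (fun l m => m != linv l) w.

Definition zpow (G : groupType) (x : G) (n : int) : G :=
  match n with
  | Posz m => (x ^+ m)%g
  | Negz m => (x ^- m.+1)%g
  end.

Definition lval (G : groupType) (x y : G) (l : letter) : G :=
  let g := if l.1 then y else x in if l.2 then (g^-1)%g else g.

(* The element w(x, y) of G obtained by substituting x and y in w. *)
Definition weval (G : groupType) (x y : G) (w : word) : G :=
  (\prod_(l <- w) lval x y l)%g.

(* G is the free group on x and y. *)
Definition free_on (G : groupType) (x y : G) : Prop :=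
  forall g : G, exists! w : word, reduced w /\ weval x y w = g.

(* A^u1 B^g1 A^u2 B^g2 ... B^g(s-1) A^us, where us = [:: u2; ...; us] and
   gs = [:: g1; ...; g(s-1)]. *)
Definition good_word (w : word) : Prop :=
  exists (u1 : int) (us gs : seq int),
    [/\ u1 = 1 \/ u1 = -1, size us = size gs,
        path (fun u u' => u' == - u) u1 us, 0 \notin gs &
        w = gpow false u1 ++
            flatten [seq gpow true gu.1 ++ gpow false gu.2 | gu <- zip gs us]].

(* The element g of the free group on A and B is a good word. Good words are
   freely reduced, so w is then the reduced word that represents g. *)
Definition is_good_word (G : groupType) (A B g : G) : Prop :=
  exists2 w : word, good_word w & weval A B w = g.

Fixpoint cfrac (a : seq nat) : rat :=
  if a is a0 :: a' then (a0%:R + cfrac a')^-1 else 0.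

Definition algo_step (XY : word * word) (a : nat) : word * word :=
  (winv XY.2, winv XY.1 ++ wexp XY.2 a).

(* No free reduction is needed along the way: winv X_l and Y_l are words in the
   two letters X^-1 and Y only (see algo_word_pos and algo_word_reduced). *)
Definition algo_word (a : seq nat) : word :=
  (foldl algo_step (gpow false 1, gpow true 1) a).2.

(* X^-1 Y^v1 ... X^-1 Y^vt *)
Definition farey_word (v : seq int) : word :=
  flatten [seq gpow false (-1) ++ gpow true n | n <- v].

(* v is the sequence of primitive exponents of the Farey word W_r: the word
   produced by a continued fraction expansion of r becomes X^-1 Y^v1 ... X^-1
   Y^vt after some cyclic permutation. *)
Definition farey_exponents (r : rat) (v : seq int) : Prop :=
  exists a : seq nat,
    [/\ a != [::], 0%N \notin a, cfrac a = r &
        exists n : nat, farey_word v = rot n (algo_word a)].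

(* W(x, y), for x and y generating G, is part of a generating pair of G. *)
Definition primitive (G : groupType) (x y : G) (w : word) : Prop :=
  exists z : G, forall g : G, exists w' : word, weval (weval x y w) z w' = g.

Definition posl (l : letter) : bool := l.1 != l.2.

Lemma weval_cat (G : groupType) (x y : G) w w' :
  weval x y (w ++ w') = (weval x y w * weval x y w')%g.
Proof. exact: big_cat. Qed.

Lemma weval_winv (G : groupType) (x y : G) w :
  weval x y (winv w) = ((weval x y w)^-1)%g.
Proof.
elim: w => [|l w IH]; first by rewrite /weval !big_nil invg1.
rewrite /winv map_cons rev_cons -cats1 weval_cat.
rewrite -/(winv w) IH [in RHS]/weval big_cons invgM; congr (_ * _)%g.
by case: l => [[] []]; rewrite /weval big_seq1 /lval //= invgK.
Qed.

Lemma weval_wexp (G : groupType) (x y : G) w n :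
  weval x y (wexp w n) = (weval x y w ^+ n)%g.
Proof.
elim: n => [|n IH]; first by rewrite /weval big_nil.
by rewrite /wexp /= weval_cat -/(wexp w n) IH expgS.
Qed.

Lemma weval_gpow (G : groupType) (x y : G) i n :
  weval x y (gpow i n) = zpow (if i then y else x) n.
Proof.
have E l m : weval x y (nseq m l) = (lval x y l ^+ m)%g.
  by rewrite /weval; elim: m => [|m IH]; rewrite ?big_nil // big_cons IH expgS.
by rewrite E; case: n => m; rewrite //= expVgn.
Qed.

Definition wsubst (u v w : word) : word :=
  flatten [seq (let h := if l.1 then v else u in if l.2 then winv h else h) | l : letter <- w].

Lemma weval_wsubst (G : groupType) (x y : G) u v w :
  weval x y (wsubst u v w) = weval (weval x y u) (weval x y v) w.
Proof.
elim: w => [|l w IH]; first by rewrite /weval !big_nil.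
rewrite [RHS]/weval big_cons -/(weval _ _ w) -IH [LHS]weval_cat; congr (_ * _)%g.
by case: l => [[] []]; rewrite /lval /= ?weval_winv.
Qed.

Lemma winvK : involutive winv.
Proof.
move=> w; rewrite /winv map_rev revK -map_comp -[RHS]map_id.
by apply: eq_map => -[i s]; rewrite /linv /= negbK.
Qed.

Lemma pos_reduced w : all posl w -> reduced w.
Proof.
case: w => //= l w; elim: w l => //= m w IH l /and3P[pl pm pw].
rewrite IH /= ?pm // andbT; apply: contraTneq pm => ->.
by move: pl; rewrite /posl /linv; case: l => [[] []].
Qed.

Lemma algo_fold_pos XY a : all posl (winv XY.1) -> all posl XY.2 ->
  all posl (foldl algo_step XY a).2.
Proof.
elim: a XY => //= n a IH [X Y] /= pX pY; apply: IH => /=; first by rewrite winvK.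
by rewrite all_cat pX /=; elim: n => //= n IHn; rewrite all_cat pY.
Qed.

Lemma algo_word_pos a : all posl (algo_word a).
Proof. exact: algo_fold_pos. Qed.

Lemma algo_word_reduced a : reduced (algo_word a).
Proof. exact/pos_reduced/algo_word_pos. Qed.

Lemma algo_word_primitive (G : groupType) (x y : G) a :
  free_on x y -> primitive x y (algo_word a).
Proof.
move=> fxy.
have gen2 (X Y : word) : (forall g : G, exists w, weval (weval x y X) (weval x y Y) w = g) ->
    primitive x y (foldl algo_step (X, Y) a).2.
  elim: a X Y => [|n a IH] X Y gXY /=.
    exists (weval x y X) => g; have [w <-] := gXY g.
    exists (map (fun l => (~~ l.1, l.2)) w).
    by rewrite /weval big_map; apply: eq_bigr => -[[] []] _.
  apply: IH => g; have [w <-] := gXY g.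
  rewrite weval_winv weval_cat weval_winv weval_wexp.
  move: (weval x y X) (weval x y Y) => p q.
  pose X' : word := wexp (gpow false (-1)) n ++ gpow true (-1).
  have evX : weval (q^-1)%g (p^-1 * q ^+ n)%g X' = p.
    rewrite weval_cat weval_wexp !weval_gpow /= !expg1 invgK invgM invgK.
    by rewrite mulgA mulgV mul1g.
  have evY : weval (q^-1)%g (p^-1 * q ^+ n)%g (gpow false (-1)) = q.
    by rewrite weval_gpow /= expg1 invgK.
  exists (wsubst X' (gpow false (-1)) w).
  by rewrite weval_wsubst evX evY.
apply: gen2 => g; have [w [[_ <-] _]] := fxy g.
by exists w; rewrite !weval_gpow /= !expg1.
Qed.

(* Exponent sum of the generator number i. *)
Definition esum (i : bool) (w : word) : int :=
  \sum_(l <- w | l.1 == i) (-1) ^+ l.2.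

Lemma esum_cat i w w' : esum i (w ++ w') = esum i w + esum i w'.
Proof. exact: big_cat. Qed.

Lemma esum_rot i n w : esum i (rot n w) = esum i w.
Proof. by rewrite /rot esum_cat addrC -esum_cat cat_take_drop. Qed.

Lemma esum_winv i w : esum i (winv w) = - esum i w.
Proof.
rewrite /esum /winv (perm_big (map linv w)) ?perm_rev //= big_map -sumrN.
by apply: eq_bigr => -[j []] _; rewrite /= ?opprK.
Qed.

Lemma esum_wexp i w n : esum i (wexp w n) = esum i w *+ n.
Proof.
elim: n => [|n IH]; first by rewrite /esum big_nil.
by rewrite /wexp /= esum_cat -/(wexp w n) IH mulrS.
Qed.

Lemma esum_gpow i j n : esum i (gpow j n) = if j == i then n else 0.
Proof.
have E s m : esum i (nseq m (j, s)) = if j == i then (-1) ^+ s *+ m else 0.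
  rewrite /esum; elim: m => [|m IH]; first by rewrite big_nil if_same.
  by rewrite big_cons IH mulrS /=; case: (j == i).
rewrite E; case: eqP => // _; case: n => m /=; first by rewrite natz.
by rewrite expr1 mulNrn natz.
Qed.

Lemma cfracE (a : seq nat) : 0%N \notin a -> exists p q : nat,
  [/\ (0 < q)%N, coprime p q, a != [::] -> (0 < p)%N, cfrac a = p%:R / q%:R &
   forall i X Y, esum i (foldl algo_step (X, Y) a).2 =
                 - esum i X *+ p + esum i Y *+ q].
Proof.
elim: a => [_|n a IH].
  by exists 0%N, 1%N; split=> [||||i X Y] //=; rewrite mulr0n add0r.
rewrite inE negb_or => /andP[n0 /IH[p [q [q0 cpq _ E S]]]].
have n1 : (0 < n)%N by rewrite lt0n eq_sym.
exists q, (n * q + p)%N; split=> [||//||].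
- by rewrite addn_gt0 muln_gt0 n1 q0.
- by rewrite /coprime gcdnMDl gcdnC.
- rewrite /= E natrD natrM; have q0' : q%:R != 0 :> rat by rewrite pnatr_eq0 -lt0n.
  by rewrite -{1}[n%:R](mulfK q0') -mulrDl invf_div.
- move=> i X Y; rewrite /= S esum_winv esum_cat esum_winv esum_wexp.
  by rewrite opprK mulrnDl mulrnDr mulrnA addrC addrA.
Qed.

Lemma esum_farey_word v :
  esum false (farey_word v) = - (size v)%:Z /\
  esum true (farey_word v) = \sum_(n <- v) n.
Proof.
elim: v => [|n v [IH1 IH2]]; first by rewrite /esum !big_nil.
have -> : farey_word (n :: v) = gpow false (-1) ++ gpow true n ++ farey_word v by [].
rewrite !esum_cat !esum_gpow /= IH1 IH2 big_cons.
by split; [rewrite add0r -opprD | rewrite add0r].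
Qed.

(* W_(p/q) has t = p and v1 + ... + vt = q. *)
Lemma farey_exponents_sum r v : farey_exponents r v ->
  (size v)%:Z = numq r /\ \sum_(n <- v) n = denq r.
Proof.
case=> a [an0 a0 <- [n Ev]].
have [p [q [q0 cpq _ -> S]]] := cfracE a0.
have [] := esum_farey_word v; rewrite Ev !esum_rot /algo_word !S !esum_gpow /=.
rewrite oppr0 !mul0rn addr0 add0r mulNrn !natz => Ep <-.
have := @coprimeq_num p q cpq; have := @coprimeq_den p q cpq.
rewrite !pmulrn => -> ->; split; last by case: ifP => /eqP; lia.
by rewrite gtr0_sg // mul1r; lia.
Qed.

Lemma posl_farey_word w : all posl w ->
  exists v, farey_word v = (false, true) :: w.
Proof.
have H k : all posl w -> exists v,
    farey_word v = (false, true) :: gpow true (Posz k) ++ w.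
  elim: w k => [|[[] []] w IH] k //= pw; first by exists [:: Posz k]; rewrite /farey_word /= cats0.
    have [v Ev] := IH k.+1 pw; exists v.
    by rewrite Ev /gpow absz_nat absz_nat -(addn1 k) nseqD -catA.
  have [v Ev] := IH 0%N pw; exists (Posz k :: v).
  by rewrite /farey_word /= -/(farey_word v) Ev.
by move=> /(H 0%N).
Qed.

(* Every Farey word has a canonical form. *)
Lemma farey_exponents_exist r : 0 < r <= 1 -> exists v, farey_exponents r v.
Proof.
have cf n p q : (p < n)%N -> (0 < p <= q)%N -> exists a : seq nat,
    [/\ a != [::], 0%N \notin a & cfrac a = p%:R / q%:R].
  elim: n p q => // n IH p q lpn /andP[p0 lepq].
  have pn0 : p%:R != 0 :> rat by rewrite pnatr_eq0 -lt0n.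
  have d0 : (0%N == q %/ p)%N = false by apply/negbTE; rewrite eq_sym -lt0n divn_gt0.
  have Eq : q%:R = (q %/ p)%:R * p%:R + (q %% p)%:R :> rat.
    by rewrite -natrM -natrD -divn_eq.
  have [m0|m0] := posnP (q %% p).
    exists [:: (q %/ p)%N]; split=> //=; first by rewrite inE d0.
    by rewrite addr0 Eq m0 addr0 -[in RHS]invf_div mulfK.
  have mp : (q %% p < p)%N by rewrite ltn_mod.
  have [||a [an0 a0 Ea]] := IH (q %% p)%N p; [lia | lia |].
  exists ((q %/ p)%N :: a); split=> //=; first by rewrite inE d0.
  by rewrite Ea Eq -[in RHS]invf_div mulrDl mulfK.
move=> /andP[r0 r1].
have [|a [an0 a0 Ea]] := cf `|numq r|.+1 `|numq r|%N `|denq r|%N (ltnSn _).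
  move: r0 r1; rewrite -numq_gt0 -[r in r <= 1]divq_num_den.
  rewrite ler_pdivrMr ?ltr0z ?denq_gt0 // mul1r ler_int.
  have := denq_gt0 r; lia.
have Er : cfrac a = r.
  rewrite Ea -[RHS]divq_num_den; congr (_ / _);
  by rewrite pmulrn gez0_abs ?denq_ge0 ?numq_ge0 // ltW.
have [p [q [_ _ p0 _ S]]] := cfracE a0.
have hasx : (false, true) \in algo_word a.
  apply: contraT => nx; have := S false (gpow false 1) (gpow true 1).
  rewrite -/(algo_word a) !esum_gpow /= mul0rn addr0 /esum big_seq_cond big1.
    by have := p0 an0; lia.
  move=> [i s] /andP[lw /= /eqP i0]; have := allP (algo_word_pos a) _ lw.
  by rewrite i0 /posl /= in lw *; case: s lw; rewrite ?(negbTE nx).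
have [i w' Ew'] := rot_to hasx.
have [|v Ev] := @posl_farey_word w'.
  have := algo_word_pos a; rewrite -(eq_all_r (mem_rot i _)) Ew'.
  by case/andP.
by exists v, a; split=> //; exists i; rewrite Ev.
Qed.

(* Main.v *)
Require Import Defs.
From mathcomp Require Import all_boot all_order all_algebra.

(** Conjugation by [A] turns each syllable [C^-1 D^n] into [A B^-1 A^-1 B^n].
    Reading [WF * A] from left to right therefore gives the letters
    [A, A^-1, A, A^-1, ..., A], whose signs alternate, separated by the powers
    [B^-1, B^v1, B^-1, B^v2, ..., B^-1, B^vt].  This is a good word as soon as
    no primitive exponent [vi] vanishes, so everything rests on that fact
    ([farey_exponents_neq0]).

    A vanishing exponent is the same thing as two cyclically adjacent letters
    [X^-1] in the Farey word.  These never occur: the first step of the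
    algorithm replaces [(X, Y)] by [(Y^-1, X^-1 Y^a0)] with [a0 > 0], and all
    later steps only concatenate copies of [Y] and [X^-1 Y^a0], in each of
    which every [X^-1] is followed by a [Y]. *)

Import Order.TTheory GRing.Theory Num.Theory.
Local Open Scope ring_scope.

Definition spaced (l m : letter) : bool := l.1 || m.1.

(** Every occurrence of the first generator is followed by the second one,
    inside [w].  Unlike cyclic spacing, this is stable under concatenation; the
    initial letter [(true, false)] puts no condition on the head of [w]. *)
Definition shielded (w : word) : bool :=
  path spaced (true, false) w && (last (true, false) w).1.

Lemma shielded_cat w w' : shielded w -> shielded w' -> shielded (w ++ w').
Proof.
rewrite /shielded cat_path last_cat => /andP[-> ].
by case: (last _ w) => [[] s] //= _; case: w'.
Qed.

Lemma shielded_wexp w n : shielded w -> shielded (wexp w n).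
Proof. by move=> sw; elim: n => //= n IH; apply: shielded_cat. Qed.

Lemma shielded_cycle w : shielded w -> cycle spaced w.
Proof.
case: w => //= l w /andP[/= pw lw].
by rewrite rcons_path pw /spaced lw.
Qed.

Lemma shielded_algo_fold XY a : shielded (winv XY.1) -> shielded XY.2 ->
  shielded (foldl algo_step XY a).2.
Proof.
elim: a XY => //= n a IH [X Y] /= sX sY; apply: IH => /=; first by rewrite winvK.
by rewrite shielded_cat // shielded_wexp.
Qed.

(** The initial pair is not shielded, as [winv X] is the bare letter [X^-1];
    one step with a positive quotient is what makes both words shielded. *)
Lemma shielded_algo_word a : a != [::] -> 0%N \notin a ->
  shielded (algo_word a).
Proof.
case: a => // -[//|n] a _ _; rewrite /algo_word [foldl _ _ _]/=.
apply: shielded_algo_fold => //.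
apply: (shielded_cat [:: (false, true); (true, false)] (wexp _ n)) => //.
exact: shielded_wexp.
Qed.

Lemma farey_word_cat v v' : farey_word (v ++ v') = farey_word v ++ farey_word v'.
Proof. by rewrite /farey_word map_cat flatten_cat. Qed.

(** After a rotation, a vanishing exponent is the first one, and then the
    leading [X^-1] is followed by the [X^-1] of the next syllable, or by itself
    when there is only one syllable. *)
Lemma cycle_farey_word_neq0 v : cycle spaced (farey_word v) -> 0 \notin v.
Proof.
move=> cv; apply/negP => v0; case/splitPr: v0 cv => v1 v2.
rewrite farey_word_cat cycle_catC -farey_word_cat cat_cons.
by case: (v2 ++ v1).
Qed.

Lemma farey_exponents_neq0 r v : farey_exponents r v -> 0 \notin v.
Proof.
case=> a [an0 a0 _ [n Ev]]; apply: cycle_farey_word_neq0.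
by rewrite Ev rot_cycle shielded_cycle // shielded_algo_word.
Qed.

Definition good_signs (v : seq int) : seq int :=
  flatten [seq [:: -1; 1] | _ <- v].

Definition good_exponents (v : seq int) : seq int :=
  flatten [seq [:: -1; n] | n <- v].

Definition good_tail (v : seq int) : word :=
  flatten [seq gpow true gu.1 ++ gpow false gu.2
          | gu <- zip (good_exponents v) (good_signs v)].

Lemma good_word_tail v : 0 \notin v -> good_word (gpow false 1 ++ good_tail v).
Proof.
move=> v0; exists 1, (good_signs v), (good_exponents v); split=> //.
- by left.
- by elim: v {v0} => //= n v ->.
- by elim: v {v0} => //= n v ->; rewrite opprK eqxx.
- elim: v v0 => //= n v IH; rewrite inE negb_or => /andP[n0 /IH IHv].
  by rewrite !inE (negbTE n0).
Qed.

Lemma weval_farey_word (G : groupType) (x y : G) v :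
  weval x y (farey_word v) = (\prod_(n <- v) (x^-1 * zpow y n))%g.
Proof.
elim: v => [|n v IH]; first by rewrite /weval !big_nil.
by rewrite -cat1s farey_word_cat weval_cat IH big_cons /farey_word /= cats0
  -cat1s (weval_cat _ _ [:: _]) weval_gpow /weval big_seq1.
Qed.

(** The last [A] of each syllable of the good word is the first [A] of the
    next syllable of the Farey word: the syllables match once the factor [A]
    is moved from the left end to the right end. *)
Lemma weval_good_tail (G : groupType) (A B : G) v :
  (A * weval A B (good_tail v) =
   \prod_(n <- v) (A * B^-1 * A^-1 * zpow B n) * A)%g.
Proof.
elim: v => [|n v IH]; first by rewrite /weval !big_nil mul1g mulg1.
have -> : good_tail (n :: v) = gpow true (-1) ++ gpow false (-1) ++
    gpow true n ++ gpow false 1 ++ good_tail v.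
  by rewrite /good_tail /= -catA.
by rewrite !weval_cat !weval_gpow /= !expg1 big_cons IH !mulgA.
Qed.

Theorem proposition4p4 (G : groupType) (A B : G) (r : rat) (v : seq int) :
  free_on A B -> 0 < r <= 1 -> farey_exponents r v ->
  let C := (A * B * A^-1)%g in
  let D := B in
  let WF := weval C D (farey_word v) in
  [/\ WF = (\prod_(n <- v) (C^-1 * zpow D n))%g,
      WF = (\prod_(n <- v) (A * B^-1 * A^-1 * zpow B n))%g &
      is_good_word A B (WF * A)%g].
Proof.
move=> _ _ /farey_exponents_neq0 v0 C D WF.
have CV : (C^-1 = A * B^-1 * A^-1)%g by rewrite /C !invgM invgK mulgA.
have EC := weval_farey_word _ C D v; have EAB := EC; rewrite CV in EAB.
split=> //; exists (gpow false 1 ++ good_tail v); first exact: good_word_tail.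
by rewrite weval_cat weval_gpow /= expg1 weval_good_tail -EAB.
Qed.
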